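(* For all $x\in X$, $\rho(x)$ and $\lambda(x)$ are defined and $x\rho(x^{-3})=\lambda(x)$. In particular, if $x=\exp\left(2\pi i\frac{a}{2^n}\right)$ with $a$ odd and $n\ge0$, then $\rho(x)$ and $\lambda(x)$ lie in $\mathbb{Q}(\zeta_{2^n},\sqrt5)$ but, if $n\ge2$, they lie neither in $\mathbb{Q}(\zeta_{2^{n-1}},\sqrt5)$ nor in $\mathbb{Q}(\zeta_{2^n})$.
   Context: $\zeta_N=\exp(2\pi i/N)$. For $n\ge0$, $X_n=\{\zeta_{2^n}^a: 1\le a\le 2^n,\ a\text{ odd}\}$ is the set of primitive $2^n$th roots of unity, and $X=\bigcup_{n\ge0}X_n$. Write $[a_0;a_1,\dots,a_n]=a_0+\cfrac{1}{a_1+\cfrac{1}{\ddots+\cfrac{1}{a_n}}}$. For $n\ge0$ let $\lambda_n(x)=[x;x^2,x^4,\dots,x^{2^n}]$, and let $\rho_n(x)$ be given by $\rho_0(x)=1$, $\rho_n(x)=1+\dfrac{x}{\rho_{n-1}(x^2)}$ for $n\ge1$; a value is assigned only when no division by zero occurs. $\lambda(x)=\lim_{n\to\infty}\lambda_n(x)$ and $\rho(x)=\lim_{n\to\infty}\rho_n(x)$; ''defined'' means that $\lambda_n(x)$ (resp. $\rho_n(x)$) is defined for all sufficiently large $n$ and the limit exists in $\mathbb{C}$. *)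

(* Defs.v *)
From HB Require Import structures.
From mathcomp Require Import all_boot all_order all_algebra.
From mathcomp Require Import all_classical all_reals all_analysis.
From mathcomp Require Import complex.
Set Implicit Arguments.
Unset Strict Implicit.
Unset Printing Implicit Defensive.
Import Order.TTheory GRing.Theory Num.Theory.
Import numFieldNormedType.Exports.
Local Open Scope classical_set_scope.
Local Open Scope ring_scope.

(* [None] means that a division by zero occurs. *)
Definition divo (K : fieldType) (x : K) (y : option K) : option K :=
  obind (fun v => if v == 0 then None else Some (x / v)) y.

(* [contfrac a0 [:: a1; ...; an]] is [a0; a1, ..., an], evaluated from the
   innermost denominator outwards. *)
Fixpoint contfrac (K : fieldType) (a : K) (s : seq K) : option K :=
  if s is b :: s' then omap (fun q => a + q) (divo 1 (contfrac b s'))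
  else Some a.

Definition lambda_ (K : fieldType) (x : K) (n : nat) : option K :=
  contfrac x [seq x ^+ (2 ^ k) | k <- iota 1 n].

Fixpoint rho_ (K : fieldType) (x : K) (n : nat) : option K :=
  if n is m.+1 then omap (fun q => 1 + q) (divo x (rho_ (x ^+ 2) m))
  else Some 1.

(* For sequences of partial values.  The default 0 is irrelevant when the limit
   is defined: it then replaces only finitely many terms.  [olim u] is
   meaningful only when [olim_defined u] holds. *)
Definition olim_defined (K : numFieldType) (u : nat -> option K) : Prop :=
  (\forall n \near \oo, isSome (u n)) /\ cvgn (fun n => odflt 0 (u n)).

Definition olim (K : numFieldType) (u : nat -> option K) : K :=
  limn (fun n => odflt 0 (u n)).

Section ComplexValued.
Variable R : realType.
Implicit Type x : R[i].

Definition lambda_defined x : Prop := olim_defined (lambda_ x).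
Definition lambda x : R[i] := olim (lambda_ x).
Definition rho_defined x : Prop := olim_defined (rho_ x).
Definition rho x : R[i] := olim (rho_ x).

Definition cexp (z : R[i]) : R[i] :=
  (expR (complex.Re z))%:C%C
  * (cos (complex.Im z) +i* sin (complex.Im z))%C.

Definition zeta (N : nat) : R[i] := cexp (2 * pi%:C%C * 'i%C / N%:R).

Definition X_ (n : nat) : set R[i] :=
  [set zeta (2 ^ n) ^+ a | a in [set a : nat | (1 <= a <= 2 ^ n)%N /\ odd a]].

Definition X : set R[i] := \bigcup_n X_ n.

Definition sqrt5 : R[i] := (Num.sqrt 5)%:C%C.

End ComplexValued.

Arguments zeta {R} N.
Arguments sqrt5 {R}.
Arguments X {R}.

(* The subfield Q(A) of K generated by A; every subfield contains the prime
   field, which is Q in characteristic 0. *)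
Definition Qadjoin (K : fieldType) (A : set K) : set K :=
  smallest (fun F : set K => divring_closed [in F]) A.

(* Main.v *)
Require Import Defs.
From HB Require Import structures.
From mathcomp Require Import all_boot all_order all_algebra.
From mathcomp Require Import all_classical all_reals all_analysis.
From mathcomp Require Import complex ring lra.
Import Order.TTheory GRing.Theory Num.Theory.
Import numFieldNormedType.Exports.
Local Open Scope classical_set_scope.
Local Open Scope ring_scope.

(** Write the recursion for the limit as rho(x) = 1 + x / rho(x^2).  Squaring a
    primitive 2^(n+1)-th root of unity gives a primitive 2^n-th root of unity,
    so everything is settled by going up from x = 1, where rho_n(1) are the
    convergents of the golden ratio.  The only obstacle to passing to the limit
    in the recursion is a vanishing rho(x^2), and this is excluded by
    arithmetic: solving the recursion backwards, any field that contains x and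
    rho(x) contains rho(1), hence sqrt 5 (generates_sqrt5); since Q(x) does not
    contain sqrt 5 (sqrt5_notin), rho(x) is not in Q(x), and in particular it
    is not 0.  The same remark is the claim that rho(x) is not in Q(zeta_{2^n}).
    The recursion also shows that rho(x) is in Q(x, sqrt 5), and that
    x = (rho(x) - 1) * rho(x^2) would be in Q(x^2, sqrt 5) if rho(x) were, which
    is false for x of order at least 4 (primitive_notin).

    For lambda, dividing the n-th convergent by x turns its recursion into
    that of rho at x^-3, so that lambda_n(x) = x * rho_n(x^-3) identically
    (lambda_rho), and x^-3 is again primitive of the same order.

    The two arithmetic facts come from the tower of quadratic extensions
    Q(x) / Q(x^2) / Q(x^4) / ...  The induction (nonsquare_cyclotomic) proves
    that x, 5 x and 5 are not squares in Q(x).  Going one step up, with s^2 = d: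
    an element of F is a square in F(s) only if it or d times it is a square in
    F, and the norm of a square c s is the square -c^2 d, which, once
    i is in F, makes d a square in F. *)

Set Implicit Arguments.
Unset Strict Implicit.

(** * Generated subfields and quadratic extensions *)

Ltac in_field :=
  do ?[by [] | exact: rpred0 | exact: rpred1 | exact: rpred_nat
      | apply: rpredD | apply: rpredB | apply: rpredNr
      | apply: rpred_div | apply: rpredM | apply: rpredX].

Section Subfields.
Variable K : fieldType.
Implicit Types (A : set K) (F : divringClosed K).

Lemma Qadjoin_closed A : divring_closed [in Qadjoin A].
Proof.
split.
- by apply/mem_set => F [[F1 _ _] _]; move: F1; rewrite inE.
- move=> x y /set_mem Ax /set_mem Ay; apply/mem_set => F FA.
  have [[_ FB _] _] := FA.
  have := FB x y (mem_set (Ax _ FA)) (mem_set (Ay _ FA)).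
  by rewrite inE.
- move=> x y /set_mem Ax /set_mem Ay; apply/mem_set => F FA.
  have [[_ _ FV] _] := FA.
  have := FV x y (mem_set (Ax _ FA)) (mem_set (Ay _ FA)).
  by rewrite inE.
Qed.

(** Bundling the closure proof makes the generic closure lemmas apply to
    membership in Q(A). *)
Definition Qfield A : divringClosed K :=
  HB.pack ([in Qadjoin A] : {pred K})
    (GRing.isDivringClosed.Build K ([in Qadjoin A] : {pred K}) (@Qadjoin_closed A)).

Lemma QfieldP A x : reflect (Qadjoin A x) (x \in Qfield A).
Proof. by apply: (iffP idP) => [/set_mem|/mem_set]. Qed.

Lemma Qfield_gen A x : A x -> x \in Qfield A.
Proof. by move=> Ax; apply/mem_set => F [_]; apply. Qed.

Lemma Qfield_min A F : (forall x, A x -> x \in F) ->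
  {subset Qfield A <= F}.
Proof.
move=> AF x /set_mem /(_ [set` F]) => h.
apply: h; split; last exact: AF.
split => [|u v|u v]; rewrite !inE /=.
- exact: rpred1.
- exact: rpredB.
- exact: rpred_div.
Qed.

Definition quadratic F s : set K :=
  [set w | exists2 u, u \in F & exists2 v, v \in F & w = u + v * s].

Section Quadratic.
Variables (F : divringClosed K) (s : K).
Hypothesis s2F : s ^+ 2 \in F.

Lemma quadratic_coord0 u v : s \notin F -> u \in F -> v \in F ->
  u + v * s = 0 -> u = 0 /\ v = 0.
Proof.
move=> sF uF vF e; have [v0|v0] := eqVneq v 0.
  by move: e; rewrite v0 mul0r addr0.
have es : s = - u / v.
  by apply: (mulIf v0); rewrite mulfVK // mulrC; apply/eqP; rewrite -addr_eq0 addrC e.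
by move: sF; rewrite es rpred_div ?rpredN.
Qed.

Lemma quadratic_coord u v u' v' : s \notin F ->
  u \in F -> v \in F -> u' \in F -> v' \in F ->
  u + v * s = u' + v' * s -> u = u' /\ v = v'.
Proof.
move=> sF uF vF uF' vF' e.
have [] := @quadratic_coord0 (u - u') (v - v') sF (rpredB uF uF') (rpredB vF vF').
  transitivity (u + v * s - (u' + v' * s)); first by ring.
  by rewrite e subrr.
by move=> /subr0_eq -> /subr0_eq ->.
Qed.

(** The inverse of u' + v' s is (u' - v' s) / (u'^2 - v'^2 s^2).  The norm in the
    denominator can vanish for a nonzero element only if s is already in F, in
    which case the extension is trivial. *)
Lemma quadratic_closed : divring_closed [in quadratic F s].
Proof.
have inF x : x \in F -> x \in quadratic F s.
  by move=> xF; apply/mem_set; exists x => //; exists 0; rewrite ?rpred0 ?mul0r ?addr0.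
split.
- exact/inF/rpred1.
- move=> _ _ /set_mem [u uF [v vF ->]] /set_mem [u' uF' [v' vF' ->]].
  apply/mem_set; exists (u - u'); first exact: rpredB.
  by exists (v - v'); [exact: rpredB | ring].
move=> _ _ /set_mem [u uF [v vF ->]] /set_mem [u' uF' [v' vF' ->]].
have [sF|sF] := boolP (s \in F).
  by apply: inF; rewrite rpred_div // rpredD // rpredM.
have [N0|N0] := eqVneq (u' ^+ 2 - v' ^+ 2 * s ^+ 2) 0.
  have /eqP : (u' + v' * s) * (u' - v' * s) = 0 by rewrite -[RHS]N0; ring.
  rewrite mulf_eq0 => /orP[/eqP ->|/eqP N0'].
    by rewrite invr0 mulr0 inF ?rpred0.
  have [| -> v0] := @quadratic_coord0 u' (- v') sF uF' (rpredNr vF').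
    by rewrite mulNr.
  have -> : v' = 0 by rewrite -[v']opprK v0 oppr0.
  by rewrite mul0r addr0 invr0 mulr0 inF ?rpred0.
apply/mem_set.
exists ((u * u' - v * v' * s ^+ 2) / (u' ^+ 2 - v' ^+ 2 * s ^+ 2)).
  by in_field.
exists ((v * u' - u * v') / (u' ^+ 2 - v' ^+ 2 * s ^+ 2)).
  by in_field.
have N0' : u' + v' * s != 0.
  apply: contra N0 => /eqP e; apply/eqP.
  transitivity ((u' + v' * s) * (u' - v' * s)); first by ring.
  by rewrite e mul0r.
by field; rewrite exprMn N0 N0'.
Qed.

Definition quadratic_field : divringClosed K :=
  HB.pack ([in quadratic F s] : {pred K})
    (GRing.isDivringClosed.Build K ([in quadratic F s] : {pred K})
       quadratic_closed).

Lemma quadratic_fieldP w :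
  reflect (exists2 u, u \in F & exists2 v, v \in F & w = u + v * s)
          (w \in quadratic_field).
Proof. by apply: (iffP idP) => [/set_mem|/mem_set]. Qed.

Lemma sub_quadratic_field : {subset F <= quadratic_field}.
Proof.
by move=> x xF; apply/quadratic_fieldP; exists x => //; exists 0;
  rewrite ?rpred0 ?mul0r ?addr0.
Qed.

Lemma quadratic_field_gen : s \in quadratic_field.
Proof.
by apply/quadratic_fieldP; exists 0; rewrite ?rpred0 //; exists 1;
  rewrite ?rpred1 ?mul1r ?add0r.
Qed.

End Quadratic.

Definition square_in F y := exists2 w, w \in F & w ^+ 2 = y.

Lemma square_in_sub F F' y : {subset F <= F'} -> square_in F y -> square_in F' y.
Proof. by move=> FF' [w /FF' ? ?]; exists w. Qed.

Lemma square_inM F c y : c \in F -> c != 0 -> square_in F (c ^+ 2 * y) -> square_in F y.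
Proof.
move=> cF c0 [w wF e]; exists (w / c); first exact: rpred_div.
by rewrite exprMn e exprVn mulrAC mulfV ?mul1r // expf_neq0.
Qed.

Section SquaresInQuadratic.
Variables (F : divringClosed K) (s : K).
Hypothesis (two0 : 2 != 0 :> K) (s2F : s ^+ 2 \in F) (sF : s \notin F).

(** A square root of a + b s is found by comparing coordinates with
    (u + v s)^2 = (u^2 + v^2 s^2) + 2 u v s. *)
Lemma square_quadratic_coord a b : a \in F -> b \in F ->
  square_in (quadratic_field s2F) (a + b * s) ->
  exists u v, [/\ u \in F, v \in F, u ^+ 2 + v ^+ 2 * s ^+ 2 = a & 2 * (u * v) = b].
Proof.
move=> aF bF [_ /quadratic_fieldP [u uF [v vF ->]] e].
exists u, v.
have [] // : u ^+ 2 + v ^+ 2 * s ^+ 2 = a /\ 2 * (u * v) = b.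
  apply: (quadratic_coord sF) => //.
  - by in_field.
  - by rewrite rpredM ?rpred_nat // rpredM.
  - by rewrite -e; ring.
Qed.

(** No irrational part: one coordinate of the root vanishes, so the root is in
    F or in F s. *)
Lemma square_quadratic y : y \in F -> square_in (quadratic_field s2F) y ->
  square_in F y \/ square_in F (s ^+ 2 * y).
Proof.
move=> yF; have -> : y = y + 0 * s by rewrite mul0r addr0.
move=> /square_quadratic_coord[]; rewrite ?rpred0 // mul0r addr0.
move=> u [v [uF vF e1 /eqP]].
rewrite !mulf_eq0 (negPf two0) /= => /orP[]/eqP z.
  right; exists (v * s ^+ 2); first by rewrite rpredM.
  by rewrite -e1 z; ring.
by left; exists u; rewrite // -e1 z; ring.
Qed.

(** The norm to F is multiplicative. *)
Lemma square_norm_quadratic a b : a \in F -> b \in F ->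
  square_in (quadratic_field s2F) (a + b * s) ->
  square_in F (a ^+ 2 - b ^+ 2 * s ^+ 2).
Proof.
move=> aF bF /square_quadratic_coord[] // u [v [uF vF <- <-]].
exists (u ^+ 2 - v ^+ 2 * s ^+ 2); last by ring.
by in_field.
Qed.
End SquaresInQuadratic.

End Subfields.

(** * Squares in the fields generated by 2-power roots of unity *)

Section CyclotomicTower.
Variable K : numFieldType.
Implicit Types (F : divringClosed K) (x y : K).

Lemma primitive_pow2P m x :
  (2 ^ m.+1).-primitive_root x <-> x ^+ (2 ^ m) = -1.
Proof.
split=> [px|xm].
  have /eqP : (x ^+ (2 ^ m)) ^+ 2 = 1 by rewrite -exprM -expnSr prim_expr_order.
  rewrite sqrf_eq1 => /orP[]/eqP // /eqP.
  by rewrite -(prim_order_dvd px) dvdn_Pexp2l // ltnn.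
have x1 : x ^+ (2 ^ m.+1) = 1 by rewrite expnSr exprM xm sqrrN expr1n.
have [d pd /(dvdn_pfactor _ _ (isT : prime 2)) [k km dE]] :=
  prim_order_exists (expn_gt0 2 m.+1 : (0 < 2 ^ m.+1)%N) x1.
move: km; rewrite leq_eqVlt => /orP[/eqP <-|km]; first by rewrite -dE.
have : x ^+ (2 ^ m) == 1.
  by rewrite -(prim_order_dvd pd) dE dvdn_exp2l.
by rewrite xm eq_sym -subr_eq0 opprK -mulr2n pnatr_eq0.
Qed.

Lemma primitive_pow2_sqr n x :
  (2 ^ n.+1).-primitive_root x -> (2 ^ n).-primitive_root (x ^+ 2).
Proof.
by move=> px; have := dvdn_prim_root px (dvdn_exp2l 2 (leqnSn n));
  rewrite expnS mulnK ?expn_gt0.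
Qed.

Lemma primitive1 x : (2 ^ 0).-primitive_root x -> x = 1.
Proof. by move=> /prim_expr_order; rewrite expr1. Qed.

Lemma ratr_closed : divring_closed [in range (@ratr K)].
Proof.
split.
- by apply/mem_set; exists 1 => //; rewrite rmorph1.
- move=> _ _ /set_mem[u _ <-] /set_mem[v _ <-]; apply/mem_set.
  by exists (u - v); rewrite ?rmorphB.
- move=> _ _ /set_mem[u _ <-] /set_mem[v _ <-]; apply/mem_set.
  by exists (u / v); rewrite ?fmorph_div.
Qed.

Definition rat_field : divringClosed K :=
  HB.pack ([in range (@ratr K)] : {pred K})
    (GRing.isDivringClosed.Build K ([in range (@ratr K)] : {pred K}) ratr_closed).

(** The p-adic valuation of the square of a rational number is even. *)
Lemma nonsquare_nat (p c : nat) : prime p -> odd (logn p c) ->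
  ~ square_in rat_field (c%:R).
Proof.
move=> pp pc [_ /set_mem[q _ <-]] e.
have {e} e : q ^+ 2 = c%:R.
  by apply: (fmorph_inj (@ratr K)); rewrite rmorphXn rmorph_nat.
have c0 : (0 < c)%N by case: c pc {e} => //; rewrite logn0.
have q0 : q != 0.
  apply/eqP => q0; move/eqP: e; rewrite q0 expr0n /= eq_sym pnatr_eq0.
  by rewrite gtn_eqF.
have e1 : (`|numq q| ^ 2 = c * `|denq q| ^ 2)%N.
  have : (numq q ^+ 2)%:~R = (c%:Z * denq q ^+ 2)%:~R :> rat.
    by rewrite intrM !rmorphXn /= numqE exprMn e.
  by move=> /intr_inj /(congr1 absz); rewrite abszM !abszX.
move/(congr1 (logn p)): e1; rewrite lognM ?expn_gt0 ?absz_gt0 ?denq_neq0 //.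
rewrite !lognX => /(congr1 odd).
by rewrite oddD !oddM /= pc.
Qed.

Lemma nonsquareN (q : rat) : q < 0 -> ~ square_in rat_field (ratr q).
Proof.
move=> q0 [_ /set_mem[r _ <-]]; rewrite -rmorphXn => /fmorph_inj e.
by move: q0; rewrite -e ltNge sqr_ge0.
Qed.

(** The step from Q to Q(i), where the norm of i is 1 and gives no information:
    (u + v i)^2 = c i forces u = v or u = - v, so that 2 c or - 2 c is the
    square of 2 v. *)
Lemma nonsquare_double_i F x (c : nat) (x2F : x ^+ 2 \in F) :
  x ^+ 2 = -1 -> x \notin F -> {subset F <= rat_field} -> odd (logn 2 (2 * c)) ->
  ~ square_in (quadratic_field x2F) (c%:R * x).
Proof.
move=> x2 xF FQ oc; rewrite -[_ * x]add0r => /(square_quadratic_coord xF)[].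
- exact: rpred0.
- exact: rpred_nat.
move=> u [v [uF vF e1 e2]].
have c0 : (0 < c)%N by case: c oc {e2} => //; rewrite muln0 logn0.
have /eqP : u ^+ 2 = v ^+ 2.
  by apply/eqP; rewrite -subr_eq0 -e1 x2; apply/eqP; ring.
rewrite eqf_sqr => /orP[]/eqP uv.
  apply: (nonsquare_nat (isT : prime 2) oc); exists (2 * v).
    by rewrite rpredM ?rpred_nat ?FQ.
  by rewrite natrM -e2 uv; ring.
apply: (@nonsquareN (- (2 * c)%:R)); first by rewrite oppr_lt0 ltr0n muln_gt0.
exists (2 * v).
  by rewrite rpredM ?rpred_nat ?FQ.
by rewrite rmorphN rmorph_nat natrM -e2 uv; ring.
Qed.

(** For a nonsquare d = x^2 of F = Q(x^2), a square c x in F(x) has square norm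
    - c^2 d, and - c^2 d = (i c)^2 d would make d a square as soon as i is in F.
    The nonsquare 5 x is carried along because 5 could become a square in F(x)
    only if 5 or 5 x^2 were one in F. *)
Lemma nonsquare_cyclotomic n x : (2 ^ n.+1).-primitive_root x ->
  [/\ ~ square_in (Qfield [set x]) x, ~ square_in (Qfield [set x]) (5 * x)
    & ~ square_in (Qfield [set x]) 5].
Proof.
elim: n x => [|n IHn] x px.
  have x1 : x = -1 by move/primitive_pow2P: px.
  have FQ : {subset Qfield [set x] <= rat_field}.
    by apply: Qfield_min => _ ->; rewrite x1 rpredN1.
  split=> /(square_in_sub FQ).
  - rewrite x1 -(rmorph1 (@ratr K)) -rmorphN; exact: nonsquareN.
  - rewrite x1 mulrN1 -(rmorph_nat (@ratr K) 5) -rmorphN; exact: nonsquareN.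
  - exact: (@nonsquare_nat 5).
have [sq1 sq5x sq5] := IHn _ (primitive_pow2_sqr px).
set F := Qfield [set x ^+ 2] in sq1 sq5x sq5 *.
have x2F : x ^+ 2 \in F by apply: Qfield_gen.
have xF : x \notin F by apply/negP => xF; apply: sq1; exists x.
have two0 : 2 != 0 :> K by rewrite pnatr_eq0.
have FQ : {subset Qfield [set x] <= quadratic_field x2F}.
  by apply: Qfield_min => _ ->; apply: quadratic_field_gen.
have step (c : nat) : (0 < c)%N -> odd (logn 2 (2 * c)) ->
    ~ square_in (Qfield [set x]) (c%:R * x).
  move=> c0 oc /(square_in_sub FQ); case: n px {IHn} => [|n] px.
    have x2 : x ^+ 2 = -1 by move/primitive_pow2P: px.
    apply: nonsquare_double_i => //.
    by apply: Qfield_min => _ ->; rewrite x2 rpredN1.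
  rewrite -[_ * x]add0r => /(square_norm_quadratic xF) [].
  - exact: rpred0.
  - exact: rpred_nat.
  move=> t tF e; apply: sq1.
  (* The order of x is at least 8 here, so a power of x^2 is a square root of -1. *)
  have i2 : ((x ^+ 2) ^+ (2 ^ n)) ^+ 2 = -1.
    by move/primitive_pow2P: px => <-; rewrite -!exprM !expnS; congr (_ ^+ _); ring.
  apply: (@square_inM _ F ((x ^+ 2) ^+ (2 ^ n) * c%:R)).
  - by in_field.
  - rewrite mulf_neq0 ?pnatr_eq0 -?lt0n //; apply: contra_eq_neq i2 => ->.
    by rewrite expr0n eq_sym oppr_eq0 oner_eq0.
  by exists t => //; rewrite e exprMn i2; ring.
split.
- by rewrite -[x in square_in _ x]mul1r; exact: (step 1%N).
- exact: (step 5).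
- move=> /(square_in_sub FQ) /(square_quadratic two0 xF)[]; rewrite ?rpred_nat //.
  by rewrite mulrC.
Qed.

Lemma sqrt5_notin s5 n x : s5 ^+ 2 = 5 ->
  (2 ^ n).-primitive_root x -> s5 \notin Qfield [set x].
Proof.
move=> s5E px; apply/negP => s5F.
have sq5 : square_in (Qfield [set x]) 5 by exists s5.
case: n px => [/primitive1 x1|n /nonsquare_cyclotomic[_ _]//].
apply: (@nonsquare_nat 5 5) => //; apply: square_in_sub sq5.
by apply: Qfield_min => _ ->; rewrite x1 rpred1.
Qed.

(** If x were in F(sqrt 5) with F = Q(x^2), then x^2 would be a square there, so
    x^2 or 5 x^2 would be a square in F. *)
Lemma primitive_notin s5 n x : s5 ^+ 2 = 5 ->
  (2 ^ n.+2).-primitive_root x ->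
  x \notin Qfield [set x ^+ 2; s5].
Proof.
move=> s5E px; apply/negP => xF.
have px2 := primitive_pow2_sqr px.
have [sq1 sq5x sq5] := nonsquare_cyclotomic px2.
have two0 : 2 != 0 :> K by rewrite pnatr_eq0.
have s52 : s5 ^+ 2 \in Qfield [set x ^+ 2] by rewrite s5E rpred_nat.
have x2F : x ^+ 2 \in Qfield [set x ^+ 2] by apply: Qfield_gen.
have [] // : square_in (Qfield [set x ^+ 2]) (x ^+ 2) \/
          square_in (Qfield [set x ^+ 2]) (s5 ^+ 2 * x ^+ 2).
  apply: (@square_quadratic _ _ s5 two0 s52) => //.
  - exact: sqrt5_notin s5E px2.
  exists x => //; apply: Qfield_min xF => y [->|->].
    exact: sub_quadratic_field.
  exact: quadratic_field_gen.
by rewrite s5E.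
Qed.

Lemma Qfield_primitive n x y (B : set K) : (2 ^ n).-primitive_root x ->
  (2 ^ n).-primitive_root y -> {subset Qfield ([set x] `|` B) <= Qfield ([set y] `|` B)}.
Proof.
move=> px py; apply: Qfield_min => z [->|Bz]; last by apply: Qfield_gen; right.
have [k ->] := prim_rootP py (prim_expr_order px).
by rewrite rpredX // Qfield_gen //; left.
Qed.

End CyclotomicTower.

(** * Limits of the partial values *)

Section Limits.
Variable K : numFieldType.
Implicit Types (x l : K) (u : nat -> option K).

Definition olim_to u l :=
  (\forall n \near \oo, isSome (u n)) /\ odflt 0 (u n) @[n --> \oo] --> l.

Lemma olim_to_defined u l : olim_to u l -> olim_defined u.
Proof. by case=> us ul; split=> //; apply/cvg_ex; exists l. Qed.

Lemma olim_to_lim u l : olim_to u l -> olim u = l.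
Proof. by case=> _; apply: cvg_lim; apply: norm_hausdorff. Qed.

Lemma near_rhoS x l : l != 0 -> olim_to (rho_ (x ^+ 2)) l ->
  \forall n \near \oo, rho_ x n.+1 = Some (1 + x / odflt 0 (rho_ (x ^+ 2) n)).
Proof.
move=> l0 [us ul].
have un0 : \forall n \near \oo, odflt 0 (rho_ (x ^+ 2) n) != 0.
  exact: cvgr_neq0 ul l0.
near=> n => /=.
have : isSome (rho_ (x ^+ 2) n) by near: n.
have : odflt 0 (rho_ (x ^+ 2) n) != 0 by near: n.
by case: (rho_ (x ^+ 2) n) => //= v /negPf ->.
Unshelve. all: by end_near. Qed.

Lemma olim_to_rhoS x l : l != 0 -> olim_to (rho_ (x ^+ 2)) l ->
  olim_to (rho_ x) (1 + x / l).
Proof.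
move=> l0 xl; have rhoS := near_rhoS l0 xl; have [_ ul] := xl.
split; first by apply: near_inftyS; apply: filterS rhoS => n /= ->.
rewrite -cvg_shiftS.
have : 1 + x / odflt 0 (rho_ (x ^+ 2) n) @[n --> \oo] --> 1 + x / l.
  by apply: cvgD; [exact: cvg_cst | apply: cvgMr; exact: cvgV].
apply: cvg_trans; apply: near_eq_cvg.
by apply: filterS rhoS => n /= ->.
Qed.

(** Both sides satisfy q_0(x) = x and q_{n+1}(x) = x + 1 / q_n(x^2), the right one
    because x (1 + x^-3 / r) = x + 1 / (x^2 r); divisions by zero occur for the
    same n. *)
Lemma lambda_rho x n : x != 0 -> lambda_ x n = omap ( *%R x) (rho_ (x ^- 3) n).
Proof.
move=> + ; elim: n x => [|n IHn] x x0; first by rewrite /lambda_ /= mulr1.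
have lambdaS : lambda_ x n.+1 = omap (fun q => x + q) (divo 1 (lambda_ (x ^+ 2) n)).
  rewrite /lambda_ /= expn1; congr (omap _ (divo 1 (contfrac _ _))).
  rewrite -[2%N]/(1 + 1)%N iotaDl -map_comp; apply: eq_map => k /=.
  by rewrite -exprM -expnS.
have e : (x ^+ 2) ^- 3 = (x ^- 3) ^+ 2 by rewrite exprVn exprAC.
rewrite lambdaS IHn ?expf_neq0 // e /=.
case: (rho_ _ n) => [v|] //=.
rewrite mulf_eq0 expf_eq0 (negPf x0) andbF /=.
case: eqVneq => //= v0; congr Some; field.
by rewrite v0 x0.
Qed.

Lemma olim_to_lambda x l : x != 0 -> olim_to (rho_ (x ^- 3)) l ->
  olim_to (lambda_ x) (x * l).
Proof.
move=> x0 [us ul]; split.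
  by apply: filterS us => n; rewrite lambda_rho //; case: (rho_ _ n).
have -> : (fun n => odflt 0 (lambda_ x n)) =
    (fun n => x * odflt 0 (rho_ (x ^- 3) n)).
  apply/funext => n; rewrite lambda_rho //.
  by case: (rho_ _ n) => //=; rewrite mulr0.
exact: cvgMr.
Qed.

End Limits.

Section Golden.
Variable R : realType.

Definition golden : R := (1 + Num.sqrt 5) / 2.

Lemma golden_gt1 : 1 < golden.
Proof.
have : Num.sqrt 1 < Num.sqrt 5 :> R by rewrite ltr_sqrt ?ltr1n.
by rewrite sqrtr1 /golden; lra.
Qed.

Lemma goldenE : golden = 1 + golden^-1.
Proof.
have g0 : golden != 0 by rewrite gt_eqF // (lt_trans ltr01) // golden_gt1.
have s5 : Num.sqrt 5 ^+ 2 = 5 :> R by rewrite sqr_sqrtr.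
apply: (mulIf g0); rewrite mulrDl mulVf // /golden; nra.
Qed.

(** The map v |-> 1 + 1/v fixes the golden ratio g, and its value at v >= 1
    differs from g by |g - v| / (g v), hence contracts the distance by 1/g. *)
Lemma rho1_approx n : exists v : R, [/\ rho_ (1 : R[i]) n = Some v%:C%C, 1 <= v &
  `|golden - v| <= golden^-1 ^+ n].
Proof.
have g1 := golden_gt1.
have g0 : 0 < golden := lt_trans ltr01 g1.
elim: n => [|n [v [rv v1 vg]]].
  exists 1; split=> //; rewrite expr0 ger0_norm ?subr_ge0 ?ltW //.
  by rewrite goldenE addrAC subrr add0r invf_lt1.
have v0 : 0 < v := lt_le_trans ltr01 v1.
exists (1 + v^-1); split.
- rewrite /= expr1n rv /= eq_complex /= eqxx andbT gt_eqF //=.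
  by rewrite div1r -fmorphV -(rmorph1 (real_complex R)) -rmorphD.
- by rewrite lerDl invr_ge0 ltW.
have -> : golden - (1 + v^-1) = (v - golden) * (golden^-1 * v^-1).
  by rewrite [in LHS]goldenE; field; rewrite !gt_eqF.
rewrite normrM distrC exprSr ler_pM // normrM !gtr0_norm ?invr_gt0 //.
by rewrite ler_piMr ?invr_ge0 ?(ltW g0) // invf_le1.
Qed.

Lemma olim_to_rho1 : olim_to (rho_ (1 : R[i])) golden%:C%C.
Proof.
split; first by near=> n; have [v [-> _ _]] := rho1_approx n.
apply/cvgrPdist_le => /= e e0.
have [e' eE] : exists e', e = e'%:C%C.
  by exists (complex.Re e); rewrite RRe_real // gtr0_real.
move: e0; rewrite {}eE => e0; have {}e0 : 0 < e' by rewrite -ltcR.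
have : `|golden^-1 : R| < 1.
  have g1 := golden_gt1; have g0 := lt_trans ltr01 g1.
  by rewrite gtr0_norm ?invr_gt0 // invf_lt1.
move=> /cvg_expr /cvgrPdist_le /(_ e' e0) h.
near=> n; have [v [-> _ vg]] /= := rho1_approx n.
rewrite -rmorphB normc_def /= expr0n addr0 sqrtr_sqr lecR.
apply: (le_trans vg); have : `|0 - golden^-1 ^+ n| <= e' by near: n.
by rewrite sub0r normrN; apply: le_trans; exact: ler_norm.
Unshelve. all: by end_near. Qed.

End Golden.

(** * The complex exponential and roots of unity *)

Section Cexp.
Variable R : realType.
Implicit Types z w : R[i].

Lemma cexpD z w : cexp (z + w) = cexp z * cexp w.
Proof.
case: z w => [a b] [c d]; rewrite /cexp /= expRD cosD sinD.
by apply/eqP; rewrite eq_complex /=; apply/andP; split; apply/eqP; ring.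
Qed.

Lemma cexp0 : cexp (0 : R[i]) = 1.
Proof. by rewrite /cexp /= expR0 cos0 sin0 !complexr0 mulr1. Qed.

Lemma cexpMn z n : cexp (z *+ n) = cexp z ^+ n.
Proof. by elim: n => [|n IHn]; rewrite ?mulr0n ?cexp0 // mulrS cexpD IHn exprS. Qed.

Lemma cexpN z : cexp (- z) = (cexp z)^-1.
Proof.
have e : cexp z * cexp (- z) = 1 by rewrite -cexpD subrr cexp0.
have z0 : cexp z != 0.
  by apply: contra_eq_neq e => ->; rewrite mul0r eq_sym oner_eq0.
by rewrite -[LHS](mulKf z0) e mulr1.
Qed.

Lemma cexp_pi : cexp (pi%:C%C * 'i%C : R[i]) = -1.
Proof.
rewrite /cexp /= !(mul0r, mulr0, mulr1, subr0, addr0) expR0 cospi sinpi mul1r.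
by apply/eqP; rewrite eq_complex /= oppr0 !eqxx.
Qed.

Lemma cexp_piMz (a : int) : cexp (pi%:C%C * 'i%C * a%:~R : R[i]) = (-1) ^+ `|a|%N.
Proof.
case: a => n; first by rewrite -[n%:~R]/(n%:R) mulr_natr cexpMn cexp_pi.
rewrite NegzE mulrNz mulrN cexpN mulr_natr cexpMn cexp_pi -signr_odd.
by case: odd; rewrite ?invr1 ?invrN1.
Qed.

Lemma cexp_primitive n (a : int) : odd `|a|%N ->
  (2 ^ n).-primitive_root (cexp (2 * pi%:C%C * 'i%C * (a%:~R / 2 ^+ n)) : R[i]).
Proof.
move=> oa; case: n => [|n].
  have -> : 2 * pi%:C%C * 'i%C * (a%:~R / 2 ^+ 0) =
      pi%:C%C * 'i%C * a%:~R *+ 2 :> R[i] by rewrite expr0 divr1; ring.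
  rewrite cexpMn cexp_piMz -signr_odd oa.
  by apply: primitive_pow2_sqr; apply/primitive_pow2P.
apply/primitive_pow2P; rewrite -cexpMn.
have -> : 2 * pi%:C%C * 'i%C * (a%:~R / 2 ^+ n.+1) *+ 2 ^ n =
    pi%:C%C * 'i%C * a%:~R :> R[i].
  rewrite -mulr_natr natrX exprS; field.
  by rewrite expf_neq0 ?pnatr_eq0.
by rewrite cexp_piMz -signr_odd oa.
Qed.

Lemma zeta_primitive n : (2 ^ n).-primitive_root (zeta (2 ^ n) : R[i]).
Proof.
have := @cexp_primitive n 1 isT.
by rewrite /zeta natrX mulrA mulr1.
Qed.

Lemma X_primitive x : X x -> exists n, (2 ^ n).-primitive_root (x : R[i]).
Proof.
move=> [n _ [a [_ oa] <-]]; exists n.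
by rewrite prim_root_exp_coprime ?zeta_primitive // coprimeXr // coprimen2.
Qed.
End Cexp.

Lemma sqr_sqrt5 (R : realType) : sqrt5 ^+ 2 = 5 :> R[i].
Proof. by rewrite /sqrt5 -rmorphXn /= sqr_sqrtr // rmorph_nat. Qed.

Lemma golden_sqrt5 (R : realType) : (golden R)%:C%C = (1 + sqrt5) / 2 :> R[i].
Proof. by rewrite /golden fmorph_div rmorphD rmorph1 rmorph_nat. Qed.

Lemma primitive_pow2_neq0 (K : numFieldType) n (x : K) :
  (2 ^ n).-primitive_root x -> x != 0.
Proof. by move=> px; rewrite (prim_root_eq0 px) expn_eq0. Qed.

Lemma primitive_pow2_invX3 (K : numFieldType) n (x : K) : (2 ^ n).-primitive_root x ->
  (2 ^ n).-primitive_root (x ^- 3).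
Proof.
case: n => [px|n /primitive_pow2P xn].
  suff -> : x ^- 3 = x by [].
  by rewrite (primitive1 px) expr1n invr1.
apply/primitive_pow2P; rewrite -exprVn exprAC exprVn xn.
by rewrite invrN1 -signr_odd.
Qed.

(** * The values of rho and lambda at roots of unity *)

Section Main.
Variable R : realType.
Implicit Types (x l : R[i]) (F : divringClosed R[i]).

(** Quantifying over the field, instead of asking for sqrt 5 in Q(x, l), makes the
    property pass from x^2 to x in one step: rho(x^2) can be recovered in any
    field that contains x and rho(x). *)
Definition generates_sqrt5 x l := forall F, x \in F -> l \in F -> sqrt5 \in F.

Lemma generates_sqrt5_notin n x l : (2 ^ n).-primitive_root x ->
  generates_sqrt5 x l -> l \notin Qfield [set x].
Proof.
move=> px gl; apply/negP => lF.
have /negP := sqrt5_notin (@sqr_sqrt5 R) px; apply; apply: gl lF.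
exact: Qfield_gen.
Qed.

Lemma generates_sqrt5_neq0 n x l : (2 ^ n).-primitive_root x ->
  generates_sqrt5 x l -> l != 0.
Proof.
move=> px /(generates_sqrt5_notin px); apply: contra => /eqP ->.
exact: rpred0.
Qed.

(** That rho(x^2) is nonzero, as needed to continue the recursion, follows from
    the third conclusion of the induction hypothesis: 0 is in Q(x^2). *)
Lemma rho_limit n x : (2 ^ n).-primitive_root x ->
  exists l, [/\ olim_to (rho_ x) l, l \in Qfield [set x; sqrt5]
              & generates_sqrt5 x l].
Proof.
elim: n x => [|n IHn] x px.
  rewrite (primitive1 px); exists (golden R)%:C%C; split.
  - exact: olim_to_rho1.
  - rewrite golden_sqrt5 rpred_div ?rpred_nat // rpredD ?rpred1 //.
    by apply: Qfield_gen; right.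
  - move=> F _; rewrite golden_sqrt5 => gF.
    have -> : sqrt5 = (1 + sqrt5) / 2 * 2 - 1 :> R[i] by field.
    by rewrite rpredB ?rpred1 // rpredM ?rpred_nat.
have px2 := primitive_pow2_sqr px.
have [l [xl lF gl]] := IHn _ px2.
have l0 := generates_sqrt5_neq0 px2 gl.
exists (1 + x / l); split; first exact: olim_to_rhoS.
- rewrite rpredD ?rpred1 // rpred_div //; first by apply: Qfield_gen; left.
  apply: Qfield_min lF => y [->|->]; last by apply: Qfield_gen; right.
  by rewrite rpredX // Qfield_gen //; left.
move=> F xF lF'; apply: gl; first exact: rpredX.
have x0 := primitive_pow2_neq0 px.
have -> : l = x / (1 + x / l - 1).
  by rewrite addrAC subrr add0r invf_div mulrCA mulfV ?mulr1.
by rewrite rpred_div // rpredB ?rpred1.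
Qed.

Lemma rho_limitS n x : (2 ^ n.+1).-primitive_root x ->
  exists l, [/\ l != 0, l \in Qfield [set x ^+ 2; sqrt5]
              & olim_to (rho_ x) (1 + x / l)].
Proof.
move=> px; have px2 := primitive_pow2_sqr px.
have [l [xl lF gl]] := rho_limit px2.
have l0 := generates_sqrt5_neq0 px2 gl.
by exists l; split; [exact: l0 | exact: lF | exact: olim_to_rhoS].
Qed.

Lemma rho_notin n x : (2 ^ n.+2).-primitive_root x ->
  rho x \notin Qfield [set x ^+ 2; sqrt5].
Proof.
move=> px; have [l [l0 lF /olim_to_lim]] := rho_limitS px.
rewrite /rho => ->; apply: contra (primitive_notin (@sqr_sqrt5 R) px) => rF.
have xE : x = (1 + x / l - 1) * l by field.
by rewrite [X in X \in _]xE rpredM // rpredB ?rpred1.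
Qed.

(** With l = rho(x^-6), lambda(x) = x rho(x^-3) = x + x^-2 / l, and the last term
    is in Q(x^2, sqrt 5). *)
Lemma lambda_notin n x : (2 ^ n.+2).-primitive_root x ->
  lambda x \notin Qfield [set x ^+ 2; sqrt5].
Proof.
move=> px; have x0 := primitive_pow2_neq0 px.
have x2F : x ^+ 2 \in Qfield [set x ^+ 2; sqrt5] by apply: Qfield_gen; left.
have [l [l0 lF xl]] := rho_limitS (primitive_pow2_invX3 px).
have {}lF : l \in Qfield [set x ^+ 2; sqrt5].
  apply: Qfield_min lF => y [->|->]; last by apply: Qfield_gen; right.
  by rewrite -exprVn exprAC exprVn rpredX // rpredV.
have /olim_to_lim := olim_to_lambda x0 xl.
rewrite /lambda => ->; apply: contra (primitive_notin (@sqr_sqrt5 R) px) => rF.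
have xE : x = x * (1 + x ^- 3 / l) - (x ^+ 2)^-1 / l.
  by field; rewrite l0 x0.
by rewrite [X in X \in _]xE rpredB ?rpred_div ?rpredV.
Qed.

End Main.

Lemma rho_lambda_primitive (R : realType) n (x : R[i]) : (2 ^ n).-primitive_root x ->
  [/\ rho_defined x, lambda_defined x & x * rho (x ^- 3) = lambda x].
Proof.
move=> px; have x0 := primitive_pow2_neq0 px.
have [l [/olim_to_defined xl _ _]] := rho_limit px.
have [l' [xl' _ _]] := rho_limit (primitive_pow2_invX3 px).
have xL := olim_to_lambda x0 xl'.
split; [exact: xl | exact: olim_to_defined xL |].
by rewrite /rho (olim_to_lim xl') /lambda (olim_to_lim xL).
Qed.

Lemma rho_in (R : realType) n (x : R[i]) : (2 ^ n).-primitive_root x ->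
  rho x \in Qfield [set x; sqrt5].
Proof.
by move=> px; have [l [/olim_to_lim + + _]] := rho_limit px; rewrite /rho => ->.
Qed.

Lemma rho_generates_sqrt5 (R : realType) n (x : R[i]) : (2 ^ n).-primitive_root x ->
  generates_sqrt5 x (rho x).
Proof.
by move=> px; have [l [/olim_to_lim + _ +]] := rho_limit px; rewrite /rho => ->.
Qed.

Theorem proposition1p2p18 (R : realType) :
  (forall x : R[i], X x ->
     [/\ rho_defined x, lambda_defined x & x * rho (x ^- 3) = lambda x])
  /\
  (forall (n : nat) (a : int) (x : R[i]), odd `|a|%N ->
     x = cexp (2 * pi%:C%C * 'i%C * (a%:~R / 2 ^+ n)) ->
     [/\ Qadjoin [set zeta (2 ^ n); sqrt5] (rho x),
         Qadjoin [set zeta (2 ^ n); sqrt5] (lambda x)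
       & (2 <= n)%N ->
         [/\ ~ Qadjoin [set zeta (2 ^ n.-1); sqrt5] (rho x),
             ~ Qadjoin [set zeta (2 ^ n)] (rho x),
             ~ Qadjoin [set zeta (2 ^ n.-1); sqrt5] (lambda x)
           & ~ Qadjoin [set zeta (2 ^ n)] (lambda x)]]).
Proof.
split=> [x /X_primitive [n]|n a x oa xE]; first exact: rho_lambda_primitive.
have px : (2 ^ n).-primitive_root x by rewrite xE cexp_primitive.
have px3 := primitive_pow2_invX3 px.
have pz := zeta_primitive R n.
have x0 := primitive_pow2_neq0 px.
have xz : x \in Qfield [set zeta (2 ^ n)].
  by have [k ->] := prim_rootP pz (prim_expr_order px); rewrite rpredX // Qfield_gen.
have [_ _ lE] := rho_lambda_primitive px.
have rz := Qfield_primitive px pz (rho_in px).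
have rz3 := Qfield_primitive px3 pz (rho_in px3).
have lz : lambda x \in Qfield [set zeta (2 ^ n); sqrt5].
  rewrite -lE rpredM //; apply: (Qfield_primitive px pz).
  by apply: Qfield_gen; left.
split; [exact/QfieldP | exact/QfieldP |].
case: n {oa xE} px px3 pz xz rz rz3 lz => [|[|n]] // px px3 pz xz rz rz3 lz _ /=.
have px2 := primitive_pow2_sqr px.
have pz1 := zeta_primitive R n.+1.
have s5z := sqrt5_notin (@sqr_sqrt5 R) pz.
split=> /QfieldP.
- by move/(Qfield_primitive pz1 px2); apply/negP/(rho_notin px).
- by move=> rF; apply: (negP s5z); exact: rho_generates_sqrt5 px _ xz rF.
- by move/(Qfield_primitive pz1 px2); apply/negP/(lambda_notin px).
- move=> lF; have : rho (x ^- 3) \in Qfield [set zeta (2 ^ n.+2)].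
    by rewrite -[rho _](mulKf x0) lE rpredM // rpredV.
  move=> rF; apply: (negP s5z); apply: (rho_generates_sqrt5 px3) rF.
  by rewrite rpredV rpredX.
Qed.
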